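(* Let $n$ be a positive integer and let $q$ be a prime power. Let $r,k\in\mathbb{N}$ be such that $r$ is a divisor of $q^n-1$, $k<n/2$, there exists a degree $k$ factor of $x^n-1$ in $\mathbb{F}_q[x]$, and $(n-k)^2\leq q$. If $$q^{\frac{n}{2}-k}\geq r(n-k+2)\,W(q^n-1),$$ then there exists an element of $\mathbb{F}_{q^n}$ which is both $r$-primitive and $k$-normal over $\mathbb{F}_q$.
   Context: $\mathbb{F}_{q^n}$ is the finite field with $q^n$ elements. For a positive integer $t$, $W(t)$ is the number of square-free (positive) divisors of $t$. For a divisor $r$ of $q^n-1$, an element $\alpha \in \mathbb{F}_{q^n}^*$ is $r$-primitive if its multiplicative order is $(q^n-1)/r$. An element $\alpha \in \mathbb{F}_{q^n}$ is $k$-normal over $\mathbb{F}_q$ (where $0\le k\le n-1$) if the greatest common divisor in $\mathbb{F}_{q^n}[x]$ of $x^n-1$ and $g_\alpha(x)=\sum_{i=0}^{n-1}\alpha^{q^i}x^{n-1-i}$ has degree $k$. *)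

(* Defs.v *)
From HB Require Import structures.
From mathcomp Require Import all_boot all_order all_algebra all_field.
Set Implicit Arguments.
Unset Strict Implicit.
Unset Printing Implicit Defensive.
Import GRing.Theory.
Local Open Scope ring_scope.

(* The bound [m <= d] is harmless for [d > 0]; 0 is not squarefree. *)
Definition squarefree (d : nat) : bool :=
  [forall m : 'I_d.+1, (m ^ 2 %| d)%N ==> (m == 1 :> nat)].

Definition W (t : nat) : nat := count squarefree (divisors t).

Section RPrimitiveKNormal.
Variables (F : finFieldType) (L : fieldExtType F).
Implicit Types alpha : L.

Let q : nat := #|F|.
Let n : nat := \dim {:L}.

(* [m.-primitive_root alpha] says that [m > 0] is the least positive exponent
   with [alpha ^+ m = 1], i.e. that [alpha] has multiplicative order [m]; in
   particular [alpha] is then nonzero. *)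
Definition r_primitive (r : nat) alpha : bool :=
  (r %| (q ^ n).-1)%N && (((q ^ n).-1 %/ r)%N).-primitive_root alpha.

Definition g_poly alpha : {poly L} :=
  \sum_(i < n) alpha ^+ (q ^ i)%N *: 'X^(n.-1 - i).

(* [gcdp] is a gcd up to a nonzero constant, so its size is still the degree
   of the gcd plus one. *)
Definition k_normal (k : nat) alpha : bool :=
  (k < n)%N && (size (gcdp ('X^n - 1) (g_poly alpha)) == k.+1).

End RPrimitiveKNormal.

(* Main.v *)
Require Import Defs.
From HB Require Import structures.
From mathcomp Require Import all_boot all_order all_algebra all_fingroup.
From mathcomp Require Import all_solvable all_field.
From mathcomp Require Import reals exp.
From mathcomp Require Import ring.
Set Implicit Arguments.
Unset Strict Implicit.
Unset Printing Implicit Defensive.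
Import Order.TTheory GRing.Theory Num.Theory.
Local Open Scope ring_scope.

(** Write [K] for the field with [q ^ n] elements, [Q = q ^ n - 1], [Q' = Q / r],
    and let [f] be the given factor of degree [k], with ['X^n - 1 = g * f].

    Replacing ['X] by the Frobenius map turns a polynomial [c] over [F] into an
    [F]-linear operator [frobenius_poly c] of [K].  Multiplying [g_poly a] by [c]
    modulo ['X^n - 1] corresponds to applying that operator to [a], and the gcd
    of ['X^n - 1] and [g_poly a] has, up to a constant, its coefficients in [F];
    hence an element of the kernel [V] of [g] that lies in no kernel [V_p] of
    [g / p], for [p] an irreducible factor of [g], is [k]-normal
    ([k_normal_frobenius_poly]).
    Counting the roots of linearized polynomials gives [#|V| >= q ^ (n - k)] and
    [q * #|V_p| <= #|V|].

    It remains to find an element of order [Q'] in [V] and outside at most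
    [n - k] subgroups [V_p].  Let [N A] be the number of elements of order [Q']
    in an additive subgroup [A], and [w] the number of primes dividing [Q'].
    For [A] contained in [B], the difference between [N A] and
    [#|A| / #|B| * N B] is small ([nprim_subgroup]):
      [Q / phi(Q') * |N A - u * N B| <= r * 2 ^ w * q ^ (n / 2) * (1 - u)],
    with [u = #|A| / #|B|].  Indeed the function [1_A - u * 1_B] is a combination
    of nontrivial additive characters of total weight [1 - u], while [Q / phi(Q')]
    times the indicator of the elements of order [Q'] is a sum of [r]
    multiplicative characters times a product over the primes [p] dividing [Q']
    of differences between the trivial character and an average of [p - 1]
    others ([weightE]).  Each such factor at most doubles the bound
    [q ^ (n / 2)] on Gauss sums, which follows from Parseval's identity.

    If all elements of order [Q'] in [V] were in some [V_p], then
    [N V <= \sum_p N V_p].  Comparing each [N V_p] with [N V], and [N V] with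
    [N K = phi(Q')], contradicts the size assumption on [q]; here
    [\sum_p #|V_p| / #|V|] is at most [(n - k) / q <= 1 / (n - k)], and
    [2 ^ w <= W Q] ([exists_prim_root_avoiding]). *)

(** * Arithmetic *)

Lemma primes_dvdn_prod (s : seq nat) (p : nat) :
  all prime s -> prime p -> (p %| \prod_(x <- s) x)%N = (p \in s).
Proof.
move=> + prp; elim: s => [|x s IHs] /=.
  by rewrite big_nil dvdn1 in_nil; case: p prp => [|[]].
case/andP=> prx prs.
by rewrite big_cons Euclid_dvdM // IHs // in_cons dvdn_prime2.
Qed.

Lemma squarefree_prod_primes (s : seq nat) :
  all prime s -> uniq s -> squarefree (\prod_(x <- s) x)%N.
Proof.
move=> prs us; apply/forallP=> -[m /= _]; apply/implyP=> m2.
have prod_gt0 : (0 < \prod_(x <- s) x)%N.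
  by rewrite big_seq prodn_cond_gt0 // => i /(allP prs)/prime_gt0.
have m_gt0 : (0 < m)%N.
  by case: m m2 => //; rewrite dvd0n (gtn_eqF prod_gt0).
case: eqP => // m1.
have prp : prime (pdiv m) by rewrite pdiv_prime //; case: m m1 m_gt0 {m2} => [|[]].
set p := pdiv m in prp.
have p2 : (p ^ 2 %| \prod_(x <- s) x)%N.
  by apply: dvdn_trans m2; rewrite dvdn_exp2r // pdiv_dvd.
have ps : p \in s.
  by rewrite -primes_dvdn_prod //; apply: dvdn_trans p2; rewrite expnS dvdn_mulr.
move: p2; rewrite (perm_big _ (perm_to_rem ps)) big_cons.
rewrite expnS expn1 dvdn_pmul2l ?prime_gt0 // primes_dvdn_prod //.
  by rewrite mem_rem_uniq // inE eqxx.
by apply/allP=> x /mem_rem/(allP prs).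
Qed.

(** Distinct sets of prime divisors of [t] have distinct products, which are
    squarefree divisors of [t]. *)
Lemma expn2_primes_leq_W (t : nat) : (0 < t)%N -> (2 ^ size (primes t) <= W t)%N.
Proof.
move=> t_gt0; set ps := primes t.
have prps : all prime ps by apply/allP=> p; rewrite mem_primes; case/andP.
have ups : uniq ps by apply: primes_uniq.
pose d (m : (size ps).-tuple bool) := (\prod_(x <- mask m ps) x)%N.
have prm m : all prime (mask m ps).
  by apply/allP=> p /mem_mask/(allP prps).
have d_inj : injective d.
  move=> m1 m2 eqd; apply/val_inj => /=.
  have eqm : mask m1 ps = mask m2 ps.
    apply: (irr_sorted_eq ltn_trans ltnn).
    - exact/sorted_mask/sorted_primes/ltn_trans.
    - exact/sorted_mask/sorted_primes/ltn_trans.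
    move=> p; case: (boolP (prime p)) => [prp|nprp].
      by rewrite -!primes_dvdn_prod //; congr (_ %| _)%N.
    by apply/idP/idP => /(allP (prm _)) => prp; rewrite prp in nprp.
  apply: (@eq_from_nth _ false) => [|i]; rewrite !size_tuple // => lti.
  have := congr1 (fun s => nth 0%N ps i \in s) eqm.
  by rewrite !in_mask ?mem_nth // !index_uniq.
rewrite /W -size_filter -card_bool -(card_tuple (size ps)) cardE -(size_map d).
apply: uniq_leq_size; first by rewrite map_inj_uniq ?enum_uniq.
move=> _ /mapP[m _ ->]; rewrite mem_filter squarefree_prod_primes ?mask_uniq //=.
rewrite -dvdn_divisors //.
have: (d m %| \prod_(x <- ps) x)%N.
  rewrite /d; elim: (ps) (val m) => [|x s IHs] [|b bs] //=; rewrite ?big_nil ?dvd1n //.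
  by case: b; rewrite !big_cons ?dvdn_mul ?dvdn_mull.
move=> /dvdn_trans; apply.
rewrite [in X in (_ %| X)%N](prod_prime_decomp t_gt0) prime_decompE big_map /=.
rewrite [X in (X %| _)%N]big_seq [X in (_ %| X)%N]big_seq.
elim/big_ind2: _ => // [x1 x2 y1 y2|p]; first exact: dvdn_mul.
by rewrite -logn_gt0 => lp; rewrite dvdn_exp.
Qed.

Lemma leq_W_dvd (d t : nat) : (0 < t)%N -> (d %| t)%N ->
  (2 ^ size (primes d) <= W t)%N.
Proof.
move=> t_gt0 dt; apply: leq_trans (expn2_primes_leq_W t_gt0).
rewrite leq_exp2l // uniq_leq_size ?primes_uniq // => p.
by rewrite !mem_primes => /and3P[-> _ pd]; rewrite t_gt0 (dvdn_trans pd dt).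
Qed.

Lemma prod_primes_totient (C : numFieldType) (d : nat) : (0 < d)%N ->
  \prod_(p <- primes d) (p%:R / p.-1%:R) = d%:R / (totient d)%:R :> C.
Proof.
move=> d_gt0.
have [E1 E2] : (d = \prod_(p <- primes d) p ^ logn p d)%N /\
   (totient d = \prod_(p <- primes d) (p.-1 * p ^ (logn p d).-1))%N.
  by split; rewrite ?totientE // {1}(prod_prime_decomp d_gt0) prime_decompE big_map.
have -> : d%:R / (totient d)%:R =
   (\prod_(p <- primes d) p ^ logn p d)%:R /
   (\prod_(p <- primes d) (p.-1 * p ^ (logn p d).-1))%:R :> C by rewrite -E1 -E2.
rewrite !natr_prod -prodf_div [LHS]big_seq [RHS]big_seq.
apply: eq_bigr => p; rewrite -logn_gt0 => lp.
have prp : prime p by move: lp; rewrite logn_gt0 mem_primes => /andP[].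
have p0 : p%:R != 0 :> C by rewrite pnatr_eq0 -lt0n prime_gt0.
have p10 : p.-1%:R != 0 :> C by rewrite pnatr_eq0 -lt0n -subn1 subn_gt0 prime_gt1.
case: (logn p d) lp => // l _ /=; rewrite expnS !natrM.
have pl0 : (p ^ l)%:R != 0 :> C by rewrite natrX expf_neq0.
by field; rewrite ?p10 ?pl0.
Qed.

(** A lower bound on [q ^ (n / 2 - k)], squared and freed of real exponents. *)
Lemma powR_half_natX (R : realType) (q n k N : nat) : (0 < q)%N ->
  k%:R < n%:R / 2 :> R -> N%:R <= q%:R `^ (n%:R / 2 - k%:R) :> R ->
  ((N * q ^ k) ^ 2 <= q ^ n)%N.
Proof.
move=> q_gt0 ltk leN.
have q_gt0R : 0 < q%:R :> R by rewrite ltr0n.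
have : N%:R * q%:R ^+ k <= q%:R `^ (n%:R / 2) :> R.
  have -> : q%:R `^ (n%:R / 2) = q%:R `^ (n%:R / 2 - k%:R) * q%:R ^+ k :> R.
    by rewrite -powR_mulrn ?ltW // -powRD ?subrK //; apply/implyP=> _; rewrite gt_eqF.
  by rewrite ler_wpM2r // exprn_ge0 // ltW.
rewrite -(@ler_pXn2r _ 2) ?nnegrE ?mulr_ge0 ?powR_ge0 ?exprn_ge0 ?ler0n //.
rewrite -[in X in _ <= X]powR_mulrn ?powR_ge0 // -powRrM divfK ?pnatr_eq0 //.
by rewrite powR_mulrn ?ler0n // -!natrX -natrM -natrX ler_nat.
Qed.

(** * Irreducible factors *)

Lemma irreducible_factor (F : fieldType) (g : {poly F}) : (1 < size g)%N ->
  exists2 p : {poly F}, irreducible_poly p & p %| g.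
Proof.
have [m] := ubnP (size g); elim: m g => // m IHm g ltm g1.
have [|nirr] := boolP (boolp.asbool (irreducible_poly g)).
  by move/boolp.asboolP=> irr; exists g.
have [h] : exists h : {poly F}, [&& size h != 1%N, h %| g & ~~ (h %= g)].
  apply/boolp.not_existsP => H; move/boolp.asboolP: nirr; apply; split=> // h h1 hg.
  by move/negP: (H h); rewrite h1 hg /= negbK.
case/and3P=> h1 hg hng.
have g0 : g != 0 by rewrite -size_poly_gt0 (ltn_trans _ g1).
have h0 : h != 0 by apply: contraNneq g0 => h0; rewrite h0 dvd0p in hg.
have lthg : (size h < size g)%N.
  by rewrite ltn_neqAle dvdp_leq // andbT dvdp_size_eqp.
have [|p irrp ph] := IHm h (leq_trans lthg ltm).
  by rewrite ltn_neqAle eq_sym h1 size_poly_gt0.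
by exists p => //; apply: dvdp_trans hg.
Qed.

(** The list of the irreducible factors of [g], with repetitions: its length is
    at most the degree of [g], and every nonconstant divisor of [g] is a
    multiple of one of its elements. *)
Lemma irreducible_factors (F : fieldType) (g : {poly F}) : g != 0 ->
  exists s : seq {poly F}, [/\ (size s < size g)%N,
    forall p, p \in s -> (1 < size p)%N && (p %| g) &
    forall e, e %| g -> (1 < size e)%N -> exists2 p, p \in s & p %| e].
Proof.
have [m] := ubnP (size g); elim: m g => // m IHm g ltm g0.
have [g1|g1] := ltnP 1 (size g); last first.
  exists [::]; split=> //; first by rewrite size_poly_gt0.
  by move=> e /(dvdp_leq g0) le1 /leq_trans/(_ le1); rewrite ltnNge g1.
have [p irrp pg] := irreducible_factor g1.
have [h gE] := dvdpP _ _ pg.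
have h0 : h != 0 by apply: contraNneq g0 => h0; rewrite gE h0 mul0r.
have p0 := irredp_neq0 irrp.
have p1 : (1 < size p)%N by case: irrp.
have sg : size g = (size h + (size p).-1)%N.
  by rewrite gE size_mul // -subn1 -addnBA ?subn1 // size_poly_gt0.
have lthg : (size h < size g)%N by rewrite sg -addn1 leq_add2l -ltnS prednK ?size_poly_gt0.
have [s [ss sdiv smeet]] := IHm h (leq_trans lthg ltm) h0.
exists (p :: s); split.
- by rewrite /= (leq_ltn_trans ss).
- move=> p'; rewrite inE => /orP[/eqP->|/sdiv/andP[-> p'h]]; first by rewrite p1.
  by rewrite gE dvdp_mulr.
move=> e eg e1; have [pe|npe] := boolP (p %| e); first by exists p; rewrite ?mem_head.
have ceh : e %| h.
  have cep : coprimep e p by rewrite coprimep_sym irreducible_poly_coprime.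
  by rewrite -(Gauss_dvdpl h cep) -gE.
by have [p' p's p'e] := smeet e ceh e1; exists p' => //; rewrite inE p's orbT.
Qed.

(** * Additive characters and Gauss sums *)

(** [A] is a subgroup of the additive group of [K]. *)
Definition additive_subgroup (K : finFieldType) (A : {set K}) : Prop :=
  [/\ {in A &, forall u v, u + v \in A}, {in A, forall u, - u \in A} & 0 \in A].

Lemma additive_subgroupT (K : finFieldType) : additive_subgroup [set: K].
Proof. by split=> [y z _ _|y _|]; apply: in_setT. Qed.

(** If [K] has characteristic [p], compose an ['F_p]-linear coordinate with
    the exponentiation of a primitive [p]-th root of unity. *)
Lemma exists_additive_char (K : finFieldType) : exists psi : K -> algC,
  [/\ {morph psi : x y / x + y >-> x * y}, forall x, `|psi x| = 1
    & exists x, psi x != 1].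
Proof.
have [p prp charp] := finPcharP K.
have [z prz] := C_prim_root_exists (prime_gt0 prp).
pose V : vectType 'F_p := pPrimeCharType charp.
have dimV : (0 < \dim {:V})%N.
  rewrite lt0n dimv_eq0 -subv0; apply/subvPn; exists (1 : K); first exact: memvf.
  by rewrite memv0 oner_neq0.
pose i0 := Ordinal dimV.
pose l (x : K) : 'F_p := coord (vbasis {:V}) i0 x.
exists (fun x => z ^+ l x); split.
- move=> x y; rewrite -exprD.
  have -> : l (x + y) = l x + l y by rewrite /l (raddfD (coord (vbasis {:V}) i0)).
  have -> : (l x + l y)%R = ((l x + l y) %% p)%N :> nat.
    by congr (_ %% _)%N; apply: Fp_cast.
  by apply/eqP; rewrite (eq_prim_root_expr prz) modn_mod.
- move=> x; have := prim_expr_order prz; move=> /(congr1 (fun y => `|y|)).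
  rewrite normrX normr1 => /eqP; rewrite pexpr_eq1 ?prime_gt0 // => /eqP zn.
  by rewrite normrX zn expr1n.
exists ((vbasis {:V})`_i0); have -> : l (vbasis {:V})`_i0 = 1.
  by rewrite /l coord_free ?eqxx // (basis_free (vbasisP _)).
rewrite -(prim_order_dvd prz).
by rewrite dvdn1; case: p prp {charp prz V dimV i0 l} => [|[]].
Qed.

Lemma sum_shift_periodic (V : nmodType) (Q l : nat) (f : nat -> V) :
  (forall i, f (i + Q)%N = f i) -> \sum_(i < Q) f (i + l)%N = \sum_(i < Q) f i.
Proof.
move=> perf; elim: l => [|l IHl]; first by apply: eq_bigr => i _; rewrite addn0.
rewrite -IHl; case: Q perf {IHl} => [|Q] perf; first by rewrite !big_ord0.
rewrite big_ord_recr [RHS]big_ord_recl /= addrC; congr (_ + _).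
  by rewrite addnS -addSn addnC perf.
by apply: eq_bigr => i _; rewrite /bump /= add1n addnS addSn.
Qed.

(** The unit group of [K] is generated by [w], of order [Q], and [z] is a
    primitive [Q]-th root of unity, so that the multiplicative characters of [K]
    are the maps [w ^+ i |-> z ^+ (i * j)].  The additive characters are the maps
    [x |-> psi (a * x)].  Sums over the units of [K] are indexed by the
    exponent [i]. *)
Section CharacterSums.
Variables (K : finFieldType) (w : K) (z : algC) (psi : K -> algC).
Let Q := #|K|.-1.
Hypothesis (prw : Q.-primitive_root w) (prz : Q.-primitive_root z).
Hypothesis psiD : {morph psi : x y / x + y >-> x * y}.
Hypothesis norm_psi : forall x, `|psi x| = 1.
Hypothesis psi_neq1 : exists x, psi x != 1.

Let Q_gt0 : (0 < Q)%N := prim_order_gt0 prw.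

Let norm_z : `|z| = 1.
Proof.
have := prim_expr_order prz; move=> /(congr1 (fun y => `|y|)).
by rewrite normrX normr1 => /eqP; rewrite pexpr_eq1 // => /eqP.
Qed.

Let psi0 : psi 0 = 1.
Proof.
have psi_neq0 : psi 0 != 0 by rewrite -normr_eq0 norm_psi oner_neq0.
by apply: (mulfI psi_neq0); rewrite -psiD addr0 mulr1.
Qed.

Let conj_psi x : (psi x)^* = psi (- x).
Proof.
have psi_neq0 : psi x != 0 by rewrite -normr_eq0 norm_psi oner_neq0.
apply: (mulfI psi_neq0).
by rewrite -normCK norm_psi expr1n -psiD subrr psi0.
Qed.

Let w_neq0 : w != 0.
Proof. by rewrite (prim_root_eq0 prw) -lt0n. Qed.

Let exp_logP (x : K) : x != 0 -> exists i : 'I_Q, x = w ^+ i.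
Proof.
move=> x0; have [] := @prim_rootP _ _ _ prw x; last by move=> i ->; exists i.
apply: (mulfI x0); rewrite -exprS prednK ?expf_card ?mulr1 //.
by rewrite (leq_trans Q_gt0) // leq_pred.
Qed.

(** A character that is nontrivial on [A] sums to [0] over [A]. *)
Lemma sum_additive_char (A : {set K}) (x : K) : additive_subgroup A ->
  \sum_(u in A) psi (x * u) =
    if [forall u in A, psi (x * u) == 1] then #|A|%:R else 0.
Proof.
case=> AD AN A0; case: ifP => [/forall_inP A1|/negbT].
  rewrite (eq_bigr (fun _ => 1)) ?sumr_const // => u uA.
  exact/eqP/A1.
rewrite negb_forall_in => /existsP[v /andP[vA v1]].
apply/eqP; rewrite -(mulIr_eq0 _ (mulIf (_ : psi (x * v) - 1 != 0))) ?subr_eq0 //.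
rewrite mulrBr mulr1 subr_eq0 eq_sym; apply/eqP.
rewrite mulr_suml (reindex_onto (fun u => u + v) (fun u => u - v)) /=.
  apply: eq_big => [u|u _]; last by rewrite mulrDr psiD.
  rewrite addrK eqxx andbT; apply/idP/idP => [uvA|uA]; last exact: AD.
  by rewrite -(addrK v u) AD // AN.
by move=> u _; rewrite subrK.
Qed.

Lemma sum_psi (x : K) : \sum_a psi (a * x) = if x == 0 then #|K|%:R else 0.
Proof.
under eq_bigr do rewrite mulrC.
rewrite (eq_bigl (fun a => a \in [set: K])) => [|a]; last by rewrite inE.
rewrite sum_additive_char ?cardsT; last exact: additive_subgroupT.
case: eqP => [->|/eqP x0]; last case: ifP => // /forall_inP H.
  by case: ifP => // /forall_inP[]// u _; rewrite mul0r psi0.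
have [y] := psi_neq1; have /eqP <- := H (x^-1 * y) (in_setT _).
by rewrite mulVKf // eqxx.
Qed.

(** The Gauss sum of the [j]-th multiplicative character and of the additive
    character [x |-> psi (a * x)]. *)
Definition gauss (j : nat) (a : K) : algC :=
  \sum_(i < Q) z ^+ (i * j) * psi (a * w ^+ i).

Lemma norm_gauss_shift (j l : nat) : `|gauss j (w ^+ l)| = `|gauss j 1|.
Proof.
rewrite -[LHS]mul1r -[X in X * _](expr1n _ (l * j)%N) -norm_z -normrX -normrM.
congr `|_|; rewrite /gauss mulr_sumr.
pose f i := z ^+ (i * j) * psi (w ^+ i).
rewrite (eq_bigr (fun i : 'I_Q => f (i + l)%N)); last first.
  move=> i _; rewrite /f mulnDl !exprD [w ^+ i * _]mulrC mulrA.
  by rewrite [z ^+ (i * j) * _]mulrC.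
rewrite sum_shift_periodic => [|i]; last first.
  rewrite /f [w ^+ _]exprD (prim_expr_order prw) mulr1 mulnDl exprD.
  rewrite [(Q * j)%N]mulnC [z ^+ (j * Q)]exprM exprAC.
  by rewrite (prim_expr_order prz) expr1n mulr1.
by apply: eq_bigr => i _; rewrite mul1r.
Qed.

(** Parseval: the mean square of the Gauss sums over all additive characters. *)
Lemma sum_norm_gauss (j : nat) : \sum_a `|gauss j a| ^+ 2 = #|K|%:R * Q%:R.
Proof.
transitivity (\sum_a \sum_(i < Q) \sum_(i' < Q)
   z ^+ (i * j) * (z ^+ (i' * j))^* * psi (a * (w ^+ i - w ^+ i'))).
  apply: eq_bigr => a _; rewrite normCK /gauss rmorph_sum mulr_suml.
  apply: eq_bigr => i _; rewrite mulr_sumr; apply: eq_bigr => i' _.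
  by rewrite rmorphM /= conj_psi mulrBr psiD; ring.
rewrite exchange_big /=; under eq_bigr => i _ do rewrite exchange_big /=.
rewrite (eq_bigr (fun _ => #|K|%:R)) ?sumr_const ?card_ord ?mulr_natr // => i _.
rewrite (bigD1 i) //= [X in _ + X]big1 => [|i' nii'].
  rewrite -mulr_sumr sum_psi subrr eqxx addr0 -normCK normrX norm_z expr1n.
  by rewrite expr1n mul1r.
rewrite -mulr_sumr sum_psi subr_eq0 (eq_prim_root_expr prw) !modn_small //.
by rewrite (_ : (i == i' :> nat) = false) ?mulr0 //; apply/negbTE; rewrite eq_sym.
Qed.

Lemma norm_gauss_le (j : nat) (a : K) : a != 0 -> `|gauss j a| <= sqrtC #|K|%:R.
Proof.
move=> /exp_logP[l ->]; rewrite norm_gauss_shift.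
have Q0 : 0 < Q%:R :> algC by rewrite ltr0n.
rewrite -(@ler_pXn2r _ 2) ?nnegrE ?sqrtC_ge0 ?ler0n ?normr_ge0 // sqrtCK.
rewrite -(ler_pM2r Q0) -(sum_norm_gauss j).
rewrite (bigID (fun a => a == 0)) /= -[leLHS]add0r lerD ?big_pred1_eq ?exprn_ge0 //.
have -> : \sum_(a | a != 0) `|gauss j a| ^+ 2 = \sum_(i < Q) `|gauss j (w ^+ i)| ^+ 2.
  rewrite (eq_bigl (mem [set w ^+ (i : 'I_Q) | i in [set: 'I_Q]])) => [|x].
    rewrite big_imset /=; first by apply: eq_bigl => i; rewrite in_setT.
    move=> i1 i2 _ _ /eqP; rewrite (eq_prim_root_expr prw) !modn_small // => /eqP.
    exact: val_inj.
  apply/idP/imsetP => [/exp_logP[i ->]|[i _ ->]]; first by exists i.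
  by rewrite expf_neq0.
rewrite (eq_bigr (fun _ => `|gauss j 1| ^+ 2)) => [|i _]; last by rewrite norm_gauss_shift.
by rewrite sumr_const card_ord mulr_natr.
Qed.


(** * Detecting elements of order [Q / r] *)

Variable r : nat.
Hypothesis rQ : (r %| Q)%N.
Let Q' := (Q %/ r)%N.

Let r_gt0 : (0 < r)%N := dvdn_gt0 Q_gt0 rQ.
Let QE : Q = (r * Q')%N. Proof. by rewrite mulnC divnK. Qed.
Let Q'_gt0 : (0 < Q')%N. Proof. by rewrite divn_gt0 // dvdn_leq. Qed.

Lemma sum_unity_root (N : nat) (y : algC) : y ^+ N = 1 ->
  \sum_(l < N) y ^+ l = if y == 1 then N%:R else 0.
Proof.
move=> yN; case: eqP => [->|/eqP y1].
  by rewrite (eq_bigr (fun _ => 1)) ?sumr_const ?card_ord // => i _; rewrite expr1n.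
have: (y - 1) * (\sum_(l < N) y ^+ l) = 0 by rewrite -subrX1 yN subrr.
by move/eqP; rewrite mulf_eq0 subr_eq0 (negbTE y1) => /eqP.
Qed.

(** For a prime [p] dividing [Q'], and on the exponents of the form
    [i = r * i'], this vanishes when [p] divides [i'] and is the constant
    [p / (p - 1)] otherwise. *)
Definition sieve_factor (p i : nat) : algC :=
  1 - (\sum_(1 <= s < p) z ^+ (i * (Q' %/ p * s))) / p.-1%:R.

(** A multiple of the indicator of the exponents [i] for which [w ^+ i] has
    order [Q / r]: the first factor is [r] times the indicator of the multiples
    of [r]. *)
Definition weight (i : nat) : algC :=
  (\sum_(l < r) z ^+ (i * (Q' * l))) * \prod_(p <- primes Q') sieve_factor p i.

(** A sieve factor averages one character against [p - 1] others, so that it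
    at most doubles a bound valid for all multiplicative twists of a sum. *)
Lemma norm_sum_prod_sieve_factor_le (s : seq nat) (h : nat -> algC) (B : algC) :
  all (fun p => 1 < p)%N s ->
  (forall j, `|\sum_(i < Q) z ^+ (i * j) * h i| <= B) ->
  forall j, `|\sum_(i < Q) z ^+ (i * j) * ((\prod_(p <- s) sieve_factor p i) * h i)|
    <= (2 ^ size s)%:R * B.
Proof.
elim: s h B => [|p s IHs] h B /=.
  move=> _ hB j; rewrite mul1r; apply: le_trans (hB j).
  by under eq_bigr do rewrite big_nil mul1r.
case/andP=> p1 s1 hB j.
rewrite expnSr natrM -mulrA.
rewrite (eq_bigr (fun i : 'I_Q => z ^+ (i * j) *
    ((\prod_(p <- s) sieve_factor p i) * (sieve_factor p i * h i)))); last first.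
  by move=> i _; rewrite big_cons; congr (_ * _); rewrite [RHS]mulrCA mulrA.
apply: (IHs (fun i => sieve_factor p i * h i)) => // {}j.
have p0 : 0 < p.-1%:R :> algC by rewrite ltr0n -subn1 subn_gt0.
have -> : \sum_(i < Q) z ^+ (i * j) * (sieve_factor p i * h i) =
    \sum_(i < Q) z ^+ (i * j) * h i
    - p.-1%:R^-1 * \sum_(1 <= s < p) \sum_(i < Q) z ^+ (i * (j + Q' %/ p * s)) * h i.
  rewrite exchange_big /= mulr_sumr -sumrB; apply: eq_bigr => i _.
  under [X in _ = _ - _ * X]eq_bigr => l _ do rewrite mulnDr exprD -mulrA mulrCA.
  rewrite -mulr_suml /sieve_factor /=.
  set S := \sum_(1 <= s < p) _.
  ring.
rewrite mulr_natl mulr2n; apply: le_trans (ler_normB _ _) _; apply: lerD => //.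
rewrite normrM normfV (gtr0_norm p0) ler_pdivrMl //.
apply: le_trans (ler_norm_sum _ _ _) _.
apply: le_trans (ler_sum _ (fun s _ => hB _)) _.
by rewrite sumr_const_nat subn1 mulr_natl.
Qed.

Lemma norm_sum_weight_psi_le (a : K) : a != 0 ->
  `|\sum_(i < Q) weight i * psi (a * w ^+ i)|
    <= (r * 2 ^ size (primes Q'))%:R * sqrtC #|K|%:R.
Proof.
move=> a0; rewrite natrM -mulrA.
have -> : \sum_(i < Q) weight i * psi (a * w ^+ i) = \sum_(l < r)
    \sum_(i < Q) z ^+ (i * (Q' * l)) *
      ((\prod_(p <- primes Q') sieve_factor p i) * psi (a * w ^+ i)).
  rewrite exchange_big /=; apply: eq_bigr => i _.
  by rewrite -mulr_suml /weight mulrA.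
apply: le_trans (ler_norm_sum _ _ _) _.
rewrite -[X in X%:R * _]card_ord mulr_natl -sumr_const; apply: ler_sum => l _.
apply: (@norm_sum_prod_sieve_factor_le _ (fun i => psi (a * w ^+ i))) => [|j].
  by apply/allP=> p; rewrite mem_primes => /andP[/prime_gt1].
exact: norm_gauss_le.
Qed.

(** The sum in a sieve factor, completed by the term [s = 0], is a sum of powers
    of a [p]-th root of unity. *)
Lemma sieve_factorE (p i' : nat) : p \in primes Q' ->
  sieve_factor p (r * i') = if (p %| i')%N then 0 else p%:R / p.-1%:R.
Proof.
rewrite mem_primes => /and3P[prp _ pQ']; rewrite /sieve_factor.
have p0 : p.-1%:R != 0 :> algC by rewrite pnatr_eq0 -lt0n -subn1 subn_gt0 prime_gt1.
pose y := z ^+ (r * i' * (Q' %/ p)).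
have yE : (y == 1) = (p %| i')%N.
  rewrite -(prim_order_dvd prz) QE mulnAC -mulnA dvdn_pmul2l //.
  rewrite -{1}(divnK pQ') dvdn_pmul2l // divn_gt0 ?prime_gt0 //.
  exact: dvdn_leq.
have yp : y ^+ p = 1.
  rewrite -exprM -mulnA divnK // mulnAC -QE exprM (prim_expr_order prz).
  exact: expr1n.
have := sum_unity_root yp; rewrite yE -(big_mkord xpredT (fun l => y ^+ l)).
rewrite big_ltn ?prime_gt0 // expr0.
rewrite (eq_bigr (fun s => z ^+ (r * i' * (Q' %/ p * s)))) => [|s _]; last first.
  by rewrite mulnA exprM.
move/(canRL (addKr _)) ->.
have pE : p%:R = p.-1%:R + 1 :> algC by rewrite natr1 prednK // prime_gt0.
by case: ifP => _; rewrite ?pE; field.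
Qed.

Lemma weightE (i : nat) : weight i =
  if (r %| i)%N && coprime (i %/ r) Q' then Q%:R / (totient Q')%:R else 0.
Proof.
rewrite /weight; pose y := z ^+ (i * Q').
have yE : (y == 1) = (r %| i)%N.
  by rewrite -(prim_order_dvd prz) QE dvdn_pmul2r.
have yr : y ^+ r = 1.
  by rewrite -exprM -mulnA [(Q' * r)%N]mulnC -QE mulnC exprM (prim_expr_order prz) expr1n.
rewrite (eq_bigr (fun l : 'I_r => y ^+ l)) => [|l _]; last by rewrite mulnA exprM.
rewrite sum_unity_root // yE; case: ifP => [ri|]; last by rewrite mul0r.
set i' := (i %/ r)%N => /=; have iE : i = (r * i')%N by rewrite mulnC divnK.
have -> : \prod_(p <- primes Q') sieve_factor p i =
    \prod_(p <- primes Q') (if (p %| i')%N then 0 else p%:R / p.-1%:R).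
  rewrite big_seq [RHS]big_seq; apply: eq_bigr => p pQ.
  by rewrite iE sieve_factorE.
case: ifP => [cop|ncop].
  rewrite {1}QE natrM -mulrA -prod_primes_totient // big_seq [in RHS]big_seq.
  congr (_ * _); apply: eq_bigr => p; rewrite mem_primes => /and3P[prp _ pQ'].
  case: ifP => // pi'; have : (p %| gcdn i' Q')%N by rewrite dvdn_gcd pi'.
  by rewrite (eqP cop) dvdn1; case: p prp {pQ' pi'} => [|[]].
have [p pQ pi'] : exists2 p, p \in primes Q' & (p %| i')%N.
  exists (pdiv (gcdn i' Q')); last exact: dvdn_trans (pdiv_dvd _) (dvdn_gcdl _ _).
  rewrite mem_primes Q'_gt0 (dvdn_trans (pdiv_dvd _) (dvdn_gcdr _ _)) andbT pdiv_prime //.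
  by rewrite ltn_neqAle eq_sym -/(coprime _ _) ncop gcdn_gt0 Q'_gt0 orbT.
by rewrite (big_rem p) //= pi' mul0r mulr0.
Qed.

Lemma prim_root_exp (i : nat) :
  Q'.-primitive_root (w ^+ i) = (r %| i)%N && coprime (i %/ r) Q'.
Proof.
case: (boolP (r %| i)%N) => /= ri.
  rewrite -{1}(divnK ri) mulnC exprM prim_root_exp_coprime //.
  have E : (Q %/ Q')%N = r by rewrite QE mulnK.
  by rewrite -[X in w ^+ X]E; apply: (dvdn_prim_root prw); rewrite QE dvdn_mull.
apply: contraNF ri => /prim_expr_order; rewrite -exprM => /eqP.
by rewrite -(prim_order_dvd prw) QE dvdn_pmul2r.
Qed.

(** The number of elements of [A] of multiplicative order [Q / r]. *)
Definition nprim (A : {set K}) : nat := #|[set x in A | Q'.-primitive_root x]|.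

Lemma nprim_setT : nprim setT = totient Q'.
Proof.
have prwr : Q'.-primitive_root (w ^+ r).
  by rewrite prim_root_exp dvdnn divnn r_gt0 coprime1n.
rewrite /nprim.
have -> : [set x in setT | Q'.-primitive_root x] =
    [set (w ^+ r) ^+ (i : 'I_Q') | i in [set i : 'I_Q' | coprime Q' i]].
  apply/setP=> x; rewrite !inE; apply/idP/imsetP => [prx|[i]].
    have [i xE] := prim_rootP prwr (prim_expr_order prx); exists i => //.
    by move: prx; rewrite xE prim_root_exp_coprime // inE coprime_sym.
  by rewrite inE coprime_sym => cop ->; rewrite prim_root_exp_coprime.
rewrite card_in_imset => [|i1 i2 _ _ /eqP].
  rewrite totient_count_coprime big_mkord -sum1_card big_mkcond /=.
  by apply: eq_bigr => i _; rewrite inE; case: ifP.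
by rewrite (eq_prim_root_expr prwr) !modn_small // => /eqP; apply: val_inj.
Qed.

Lemma sum_weight (A : {set K}) : \sum_(i < Q) weight i * (w ^+ i \in A)%:R =
  Q%:R / (totient Q')%:R * (nprim A)%:R.
Proof.
have -> : nprim A = #|[set i : 'I_Q | (w ^+ i \in A) && Q'.-primitive_root (w ^+ i)]|.
  rewrite -(@card_in_imset _ _ (fun i : 'I_Q => w ^+ i)) => [|i1 i2 _ _ /eqP].
    apply: eq_card => x; rewrite !inE; apply/andP/imsetP => [[xA prx]|[i]].
      have [|i xE] := exp_logP (x := x).
        by rewrite (prim_root_eq0 prx) -lt0n.
      by exists i => //; rewrite inE -xE xA.
    by rewrite inE => /andP[? ?] ->.
  by rewrite (eq_prim_root_expr prw) !modn_small // => /eqP; apply: val_inj.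
rewrite -sum1_card natr_sum mulr_sumr [RHS]big_mkcond /=; apply: eq_bigr => i _.
rewrite inE prim_root_exp weightE; case: (_ \in A) => /=; last by rewrite mulr0.
by case: ifP => _; rewrite ?mul0r.
Qed.

(** * Elements of order [Q / r] in additive subgroups *)

(** The orthogonal of [A]: the parameters of the additive characters that are
    trivial on [A]. *)
Definition perp (A : {set K}) : {set K} := [set a | [forall u in A, psi (a * u) == 1]].

(** Fourier expansion of the indicator of [A]. *)
Lemma indicator_additive_char (A : {set K}) (x : K) : additive_subgroup A ->
  (x \in A)%:R = #|A|%:R / #|K|%:R * \sum_(a in perp A) psi (a * x).
Proof.
move=> sA; have [_ AN A0] := sA.
have K0 : #|K|%:R != 0 :> algC by rewrite pnatr_eq0 -lt0n; apply/card_gt0P; exists 0.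
apply: (mulfI K0); rewrite mulrA [X in _ = X * _]mulrC divfK //.
transitivity (\sum_(u in A) \sum_a psi (a * (x - u))).
  case: (boolP (x \in A)) => xA.
    rewrite (bigD1 x) //= sum_psi subrr eqxx big1 ?addr0 ?mulr1 // => u /andP[_ ux].
    by rewrite sum_psi subr_eq0 eq_sym (negbTE ux).
  rewrite mulr0 big1 // => u uA; rewrite sum_psi subr_eq0.
  by case: eqP => // xu; rewrite xu uA in xA.
rewrite exchange_big mulr_sumr [RHS]big_mkcond /=; apply: eq_bigr => a _.
under eq_bigr do rewrite mulrBr psiD -mulrN.
rewrite -mulr_sumr; have -> : \sum_(u in A) psi (a * - u) = \sum_(u in A) psi (a * u).
  rewrite (reindex_inj oppr_inj) /=.
  apply: eq_big => [u|u _]; last by rewrite opprK.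
  by apply/idP/idP => /AN; rewrite ?opprK.
by rewrite sum_additive_char // inE mulrC; case: ifP; rewrite ?mul0r.
Qed.

(** The proportion of the elements of order [Q / r] of [B] that lie in the
    subgroup [A] is close to [#|A| / #|B|].  Only the characters trivial on [A]
    but not on [B] contribute to the error. *)
Lemma nprim_subgroup (A B : {set K}) :
  additive_subgroup A -> additive_subgroup B -> A \subset B ->
  `|Q%:R / (totient Q')%:R * ((nprim A)%:R - #|A|%:R / #|B|%:R * (nprim B)%:R)| <=
    (r * 2 ^ size (primes Q'))%:R * sqrtC #|K|%:R * (1 - #|A|%:R / #|B|%:R) :> algC.
Proof.
move=> sA sB AB; have [_ _ A0] := sA; have [_ _ B0] := sB.
set u := #|A|%:R / #|B|%:R : algC; set E := (_ * sqrtC _).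
have K0 : #|K|%:R != 0 :> algC by rewrite pnatr_eq0 -lt0n; apply/card_gt0P; exists 0.
have cB0 : #|B|%:R != 0 :> algC by rewrite pnatr_eq0 -lt0n; apply/card_gt0P; exists 0.
have perpBA : perp B \subset perp A.
  apply/subsetP=> a; rewrite !inE => /forall_inP aB; apply/forall_inP=> v /(subsetP AB).
  exact: aB.
have diffE x : (x \in A)%:R - u * (x \in B)%:R =
    #|A|%:R / #|K|%:R * \sum_(a in perp A :\: perp B) psi (a * x).
  rewrite (indicator_additive_char x sA) (indicator_additive_char x sB).
  rewrite mulrA /u mulrA divfK // -mulrBr; congr (_ * _).
  rewrite (big_setID (perp B)) /= (setIidPr perpBA).
  by rewrite addrAC subrr add0r.
have card_perp : #|A|%:R / #|K|%:R * #|perp A :\: perp B|%:R = 1 - u.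
  have := diffE 0; rewrite A0 B0 mulr1 => ->; congr (_ * _).
  rewrite (eq_bigr (fun _ => 1)) ?sumr_const // => a _.
  by rewrite mulr0 psi0.
have -> : Q%:R / (totient Q')%:R * ((nprim A)%:R - u * (nprim B)%:R) =
   #|A|%:R / #|K|%:R * \sum_(a in perp A :\: perp B)
     \sum_(i < Q) weight i * psi (a * w ^+ i).
  rewrite mulrBr [_ * (u * _)]mulrCA -!sum_weight mulr_sumr -sumrB exchange_big /=.
  rewrite mulr_sumr; apply: eq_bigr => i _.
  by rewrite mulrCA -mulrBr diffE -mulr_sumr mulrCA.
rewrite normrM normf_div !normr_nat -card_perp mulrCA.
rewrite ler_wpM2l ?divr_ge0 ?ler0n //.
apply: le_trans (ler_norm_sum _ _ _) _; rewrite mulr_natr -sumr_const.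
apply: ler_sum => a; rewrite !inE => /andP[aB _]; apply: norm_sum_weight_psi_le.
by apply: contraNneq aB => ->; apply/forall_inP=> v _; rewrite mul0r psi0.
Qed.

End CharacterSums.

(** * Linearized polynomials and normality *)

Section Linearized.
Variables (F : finFieldType) (L : fieldExtType F).
Let q := #|F|.
Let n := \dim {:L}.
Implicit Types (a b : L) (c d : {poly F}).

Let n_gt0 : (0 < n)%N.
Proof. exact: adim_gt0. Qed.

Lemma card_pchar_nat : [pchar L].-nat q.
Proof.
have [p prp charp] := finPcharP F.
have charpL : p \in [pchar L] by rewrite pchar_lalg.
by rewrite /q (card_pprimeChar charp) pnatX pnatE // charpL.
Qed.

Lemma exprD_card i a b : (a + b) ^+ (q ^ i) = a ^+ (q ^ i) + b ^+ (q ^ i).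
Proof. by rewrite exprDn_pchar // pnatX card_pchar_nat. Qed.

Lemma exprZ_card i (x : F) a : (x *: a) ^+ (q ^ i) = x *: a ^+ (q ^ i).
Proof.
rewrite exprZn; congr (_ *: _); elim: i => // i IHi.
by rewrite expnSr exprM IHi expf_card.
Qed.

Lemma expr_card_dim a : a ^+ (q ^ n) = a.
Proof. by apply/eqP; rewrite -(Fermat's_little_theorem {:L}%AS) memvf. Qed.

(** The [F]-linear operator obtained from [c] by replacing ['X] with the
    Frobenius map [a |-> a ^+ q]. *)
Definition frobenius_poly c a : L := \sum_(i < size c) c`_i *: a ^+ (q ^ i).

Lemma frobenius_poly_widen c a N : (size c <= N)%N ->
  frobenius_poly c a = \sum_(i < N) c`_i *: a ^+ (q ^ i).
Proof.
move=> leN; rewrite /frobenius_poly (big_ord_widen _ (fun i => c`_i *: a ^+ (q ^ i)) leN).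
rewrite big_mkcond; apply: eq_bigr => i _; case: ltnP => // lei.
by rewrite nth_default // scale0r.
Qed.

Lemma frobenius_polyDl c d a :
  frobenius_poly (c + d) a = frobenius_poly c a + frobenius_poly d a.
Proof.
pose N := maxn (size c) (size d).
rewrite !(@frobenius_poly_widen _ _ N) ?leq_maxl ?leq_maxr ?size_polyD //.
by rewrite -big_split; apply: eq_bigr => i _; rewrite coefD scalerDl.
Qed.

Lemma frobenius_polyC (x : F) a : frobenius_poly x%:P a = x *: a.
Proof.
rewrite (@frobenius_poly_widen _ _ 1) ?size_polyC_leq1 //.
by rewrite big_ord1 coefC expn0 expr1.
Qed.

Lemma frobenius_poly0l a : frobenius_poly 0 a = 0.
Proof. by rewrite -polyC0 frobenius_polyC scale0r. Qed.

Lemma frobenius_polyMX c a : frobenius_poly (c * 'X) a = frobenius_poly c (a ^+ q).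
Proof.
rewrite (@frobenius_poly_widen _ _ (size c).+1) ?size_polyMX_leq //; last first.
  by apply: leq_trans (size_polyMleq _ _) _; rewrite size_polyX addn2.
rewrite big_ord_recl coefMX /= scale0r add0r; apply: eq_bigr => i _.
by rewrite coefMX /= -exprM -expnS.
Qed.

Lemma frobenius_polyDr c a b :
  frobenius_poly c (a + b) = frobenius_poly c a + frobenius_poly c b.
Proof.
by rewrite -big_split; apply: eq_bigr => i _; rewrite exprD_card scalerDr.
Qed.

Lemma frobenius_poly0r c : frobenius_poly c 0 = 0.
Proof. by apply: (addrI (frobenius_poly c 0)); rewrite -frobenius_polyDr !addr0. Qed.

Lemma frobenius_polyN c a : frobenius_poly c (- a) = - frobenius_poly c a.
Proof.
by apply: (addrI (frobenius_poly c a)); rewrite -frobenius_polyDr !subrr frobenius_poly0r.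
Qed.

Lemma frobenius_polyM c d a :
  frobenius_poly (c * d) a = frobenius_poly c (frobenius_poly d a).
Proof.
elim/poly_ind: d a => [|d x IHd] a.
  by rewrite mulr0 !frobenius_poly0l frobenius_poly0r.
rewrite mulrDr mulrA !frobenius_polyDl frobenius_polyDr !frobenius_polyMX IHd.
congr (_ + _); rewrite frobenius_polyC mulrC mul_polyC.
rewrite !(@frobenius_poly_widen _ _ (size c)) ?size_scale_leq //.
by apply: eq_bigr => i _; rewrite coefZ exprZ_card !scalerA mulrC.
Qed.

Lemma frobenius_polyXn_sub1 a : frobenius_poly ('X^n - 1) a = 0.
Proof.
rewrite frobenius_polyDl -polyCN frobenius_polyC scaleN1r.
suff -> i : frobenius_poly 'X^i a = a ^+ (q ^ i) by rewrite expr_card_dim subrr.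
elim: i a => [|i IHi] a; first by rewrite expr0 frobenius_polyC scale1r expr1.
by rewrite exprSr frobenius_polyMX IHi -exprM -expnS.
Qed.

(* [c] with its coefficients viewed in [L] *)
Local Notation "c ^L" := (map_poly (in_alg L) c) (at level 2, format "c ^L").

Lemma g_polyD a b : g_poly (a + b) = g_poly a + g_poly b.
Proof. by rewrite -big_split; apply: eq_bigr => i _; rewrite exprD_card scalerDl. Qed.

Lemma g_polyZ (x : F) a : g_poly (x *: a) = x%:A *: g_poly a.
Proof.
rewrite scaler_sumr; apply: eq_bigr => i _.
by rewrite exprZ_card scalerA mulr_algl.
Qed.

Lemma size_g_poly a : (size (g_poly a) <= n)%N.
Proof.
apply: leq_trans (size_sum _ _ _) _; apply/bigmax_leqP => i _.
apply: leq_trans (size_scale_leq _ _) _.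
by rewrite size_polyXn; apply: leq_ltn_trans (leq_subr _ _) _; rewrite prednK.
Qed.

Lemma g_poly_eq0 a : (g_poly a == 0) = (a == 0).
Proof.
apply/eqP/eqP => [/(congr1 (fun p : {poly L} => p`_n.-1))|->]; last first.
  by rewrite -(scale0r 0) g_polyZ !scale0r.
rewrite coef0 coef_sum -/n -/q (bigD1 (Ordinal n_gt0)) //= coefZ coefXn subn0 eqxx.
rewrite expr1 mulr1 big1 ?addr0 // => i; rewrite -val_eqE /= => i0.
rewrite coefZ coefXn; case: eqP => [E|_]; last by rewrite mulr0.
have : (n.-1 - i < n.-1)%N.
  by rewrite ltn_subrL lt0n i0 (@leq_trans i) ?lt0n // -ltnS prednK.
by rewrite -E ltnn.
Qed.

Lemma mulX_g_poly a : 'X * g_poly a = g_poly (a ^+ q) + a *: ('X^n - 1).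
Proof.
rewrite /g_poly -/n -/q; have := expr_card_dim a; rewrite -/n.
case: (n) n_gt0 => // m _ aE /=.
rewrite big_ord_recl big_ord_recr /= subn0 subnn expr0 -exprM -expnS aE expr1.
rewrite mulrDr -scalerAr -exprS mulr_sumr scalerBr.
set S1 := \sum_(i < m) _; set S2 := \sum_(i < m) _.
have -> : S1 = S2; last first.
  by rewrite [RHS]addrC -addrA [S2 + _]addrC addKr.
apply: eq_bigr => i _.
rewrite -scalerAr -exprS -exprM -expnS /bump /= add1n -subSn //.
Qed.

(** Modulo ['X^n - 1], multiplying [g_poly a] by [c] yields the [g_poly] of
    [frobenius_poly c a]. *)
Lemma map_mul_g_poly c a :
  exists h, c^L * g_poly a = g_poly (frobenius_poly c a) + h * ('X^n - 1).
Proof.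
elim/poly_ind: c a => [|c x IHc] a.
  exists 0; rewrite rmorph0 !mul0r frobenius_poly0l addr0.
  by apply/esym/eqP; rewrite g_poly_eq0.
have [h hE] := IHc (a ^+ q); exists (h + a *: c^L).
rewrite rmorphD rmorphM /= map_polyX map_polyC /= mulrDl -mulrA mulX_g_poly.
rewrite mulrDr hE frobenius_polyDl frobenius_polyMX frobenius_polyC g_polyD g_polyZ.
by rewrite mul_polyC mulrDl -scalerAl -scalerAr; ring.
Qed.

Lemma dvdp_Xn_sub1_mul_g_poly c a :
  ('X^n - 1 %| c^L * g_poly a) = (frobenius_poly c a == 0).
Proof.
have [h ->] := map_mul_g_poly c a.
rewrite dvdp_addl ?dvdp_mull // -g_poly_eq0.
apply/idP/eqP => [dv|->]; last exact: dvdp0.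
apply/eqP; apply: contraLR dv => g0; apply/negP => /(dvdp_leq g0).
by rewrite size_Xn_sub_1 // ltnNge size_g_poly.
Qed.

(** The Frobenius map multiplies [g_poly a] by ['X] modulo ['X^n - 1], so it
    fixes the monic gcd, which therefore has coefficients in [F]. *)
Lemma gcdp_g_poly_over a : exists D : {poly F}, gcdp ('X^n - 1) (g_poly a) %= D^L.
Proof.
have fD : {morph (fun x : L => x ^+ q) : x y / x + y}.
  by move=> x y; have := exprD_card 1 x y; rewrite expn1.
have fA : zmod_morphism (fun x : L => x ^+ q).
  by move=> x y /=; apply: (addIr (y ^+ q)); rewrite subrK -fD subrK.
have fM : monoid_morphism (fun x : L => x ^+ q).
  by split=> [|x y]; rewrite ?exprMn ?expr1n.
pose faM := GRing.isZmodMorphism.Build _ _ (fun x : L => x ^+ q) fA.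
pose fmM := GRing.isMonoidMorphism.Build _ _ (fun x : L => x ^+ q) fM.
pose f : {rmorphism L -> L} := HB.pack (fun x : L => x ^+ q) faM fmM.
set G := gcdp _ _.
have X0 : 'X^n - 1 != 0 :> {poly L} by rewrite -size_poly_eq0 size_Xn_sub_1.
have G0 : G != 0 by rewrite gcdp_eq0 negb_and X0.
pose D := (lead_coef G)^-1 *: G.
have lG : lead_coef G != 0 by rewrite lead_coef_eq0.
have monD : D \is monic by rewrite monicE lead_coefZ mulVf.
have GD : G %= D by rewrite eqp_sym eqp_scale ?invr_eq0.
have fG : map_poly f G %= G.
  have fX1 : map_poly f ('X^n - 1) = 'X^n - 1.
    by rewrite rmorphB rmorph1; congr (_ - _); apply: map_polyXn.
  rewrite gcdp_map fX1.
  have -> : map_poly f (g_poly a) = g_poly (a ^+ q).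
    rewrite /g_poly rmorph_sum; apply: eq_bigr => i _.
    rewrite [LHS](map_polyZ f) (map_polyXn f); congr (_ *: _).
    by rewrite -[LHS]exprM -exprM mulnC.
  have -> : g_poly (a ^+ q) = 'X * g_poly a - a *: ('X^n - 1).
    by rewrite mulX_g_poly addrK.
  have copX : coprimep ('X^n - 1 : {poly L}) 'X.
    have -> : 'X^n - 1 = 'X^(n.-1) * 'X - 1 :> {poly L} by rewrite -exprSr prednK.
    rewrite coprimep_sym; apply/Bezout_eq1_coprimepP; exists ('X^(n.-1), -1) => /=.
    ring.
  apply/andP; split; rewrite dvdp_gcd dvdp_gcdl /=.
    have : gcdp ('X^n - 1) ('X * g_poly a - a *: ('X^n - 1)) %| 'X * g_poly a.
      rewrite -[X in _ %| X](subrK (a *: ('X^n - 1))) dvdp_add ?dvdp_gcdr //.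
      by rewrite -mul_polyC dvdp_mull ?dvdp_gcdl.
    rewrite Gauss_dvdpr //; apply: coprimep_dvdr copX; exact: dvdp_gcdl.
  rewrite dvdp_sub ?dvdp_mull ?dvdp_gcdr //.
  by rewrite -mul_polyC dvdp_mull ?dvdp_gcdl.
have fDD : map_poly f D = D.
  apply/eqP; rewrite -eqp_monic ?map_monic //.
  apply: eqp_trans (_ : map_poly f G %= _); first by rewrite eqp_map eqp_sym.
  exact: eqp_trans fG GD.
have /polyOver1P[D0 DE] : D \is a polyOver 1%VS.
  apply/polyOverP => i; rewrite Fermat's_little_theorem dimv1 expn1.
  by rewrite -[X in _ == X](congr1 (fun p : {poly L} => p`_i) fDD) coef_map.
by exists D0; rewrite -DE.
Qed.

(** The kernel consists of roots of a polynomial of degree [q ^ deg c]. *)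
Lemma size_frobenius_poly_kernel c (s : seq L) : c != 0 -> uniq s ->
  all (fun a => frobenius_poly c a == 0) s -> (size s <= q ^ (size c).-1)%N.
Proof.
move=> c0 us /allP s0; have q1 : (1 < q)%N by apply: finNzRing_gt1.
pose P : {poly L} := \sum_(i < size c) (c`_i)%:A *: 'X^(q ^ i).
have sc : (0 < size c)%N by rewrite size_poly_gt0.
have lt_ic (i : 'I_(size c)) : (i <= (size c).-1)%N by rewrite -ltnS prednK.
have szP : (size P <= (q ^ (size c).-1).+1)%N.
  apply: leq_trans (size_sum _ _ _) _; apply/bigmax_leqP => i _.
  apply: leq_trans (size_scale_leq _ _) _.
  by rewrite size_polyXn ltnS leq_pexp2l // ltnW.
rewrite -ltnS; apply: leq_trans szP; apply: max_poly_roots => //.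
  have lt_max : ((size c).-1 < size c)%N by rewrite prednK.
  apply: contraNneq c0 => /(congr1 (fun p : {poly L} => p`_(q ^ (size c).-1))).
  rewrite coef0 coef_sum (bigD1 (Ordinal lt_max)) //= coefZ coefXn eqxx mulr1.
  rewrite big1 ?addr0 => [/eqP|i]; last first.
    rewrite -val_eqE /= => ni; rewrite coefZ coefXn eqn_exp2l // eq_sym (negbTE ni).
    exact: mulr0.
  by rewrite scaler_eq0 oner_eq0 orbF -lead_coef_eq0 /lead_coef.
apply/allP => a /s0 /eqP a0; rewrite rootE -a0 /P horner_sum; apply/eqP.
by apply: eq_bigr => i _; rewrite hornerZ hornerXn mulr_algl.
Qed.

(** Let ['X^n - 1 = g * f] with [f] of degree [k], and suppose that every
    nonconstant divisor of [g] is a multiple of an element of [s].  If [a] is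
    annihilated by [g] but by no [g / p] with [p] in [s], then [a] is [k]-normal.
    Indeed [f] divides the gcd [D] of ['X^n - 1] and [g_poly a], and
    [g * f / D] annihilates [a]. *)
Lemma k_normal_frobenius_poly (f g : {poly F}) (s : seq {poly F}) (k : nat) a :
  (k < n)%N -> 'X^n - 1 = g * f -> size f = k.+1 ->
  (forall e, e %| g -> (1 < size e)%N -> exists2 p, p \in s & p %| e) ->
  (forall p, p \in s -> p != 0) ->
  frobenius_poly g a = 0 ->
  (forall p, p \in s -> frobenius_poly (g %/ p) a != 0) ->
  k_normal k a.
Proof.
move=> ltkn XE sf smeet s0 ga pa; rewrite /k_normal -/n ltkn /=.
have X0 : 'X^n - 1 != 0 :> {poly F} by rewrite -size_poly_eq0 size_Xn_sub_1.
have X0L : 'X^n - 1 != 0 :> {poly L} by rewrite -size_poly_eq0 size_Xn_sub_1.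
have XL : ('X^n - 1)^L = 'X^n - 1 by rewrite rmorphB rmorph1 /= map_polyXn.
have [g0 f0] : g != 0 /\ f != 0 by apply/andP; rewrite -negb_or -mulf_eq0 -XE.
have [D GD] := gcdp_g_poly_over a.
rewrite (eqp_size GD) size_map_poly.
have DX : D %| 'X^n - 1 by rewrite -(dvdp_map (in_alg L)) XL -(eqp_dvdl _ GD) dvdp_gcdl.
have fD : f %| D.
  rewrite -(dvdp_map (in_alg L)) -(eqp_dvdr _ GD) dvdp_gcd -{1}XL dvdp_map {1}XE.
  rewrite dvdp_mull //=.
  have := dvdp_Xn_sub1_mul_g_poly g a; rewrite ga eqxx -XL XE rmorphM dvdp_mul2l //.
  by rewrite map_poly_eq0.
have [e DE] := dvdpP _ _ fD; have [h XDE] := dvdpP _ _ DX.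
have gE : g = h * e.
  by apply: (mulIf f0); rewrite -XE XDE DE mulrA.
have ha : frobenius_poly h a = 0.
  apply/eqP; rewrite -dvdp_Xn_sub1_mul_g_poly -XL XDE rmorphM dvdp_mul //.
  by rewrite -(eqp_dvdl _ GD) dvdp_gcdr.
have e0 : e != 0 by apply: contraNneq g0 => e0; rewrite gE e0 mulr0.
have e1 : (size e <= 1)%N.
  rewrite leqNgt; apply/negP => e1.
  have [|p ps pe] := smeet e _ e1; first by rewrite gE dvdp_mull.
  have [e' eE] := dvdpP _ _ pe.
  have := pa p ps; rewrite gE eE mulrA mulpK ?s0 // mulrC frobenius_polyM ha.
  by rewrite frobenius_poly0r eqxx.
have /eqP/size_poly1P[x x0 eE] : size e = 1%N.
  by apply/eqP; rewrite eqn_leq e1 size_poly_gt0.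
by rewrite DE eE mul_polyC size_scale // sf.
Qed.

End Linearized.

(** * The sieve *)

Lemma exists_field_generator (K : finFieldType) :
  exists w : K, (#|K|.-1).-primitive_root w.
Proof.
have K1 : (1 < #|K|)%N := finNzRing_gt1 K.
have : has (#|K|.-1).-primitive_root [seq x <- enum K | x != 0].
  apply: has_prim_root.
  - by rewrite -subn1 subn_gt0.
  - apply/allP=> x; rewrite mem_filter => /andP[x0 _].
    rewrite unity_rootE; apply/eqP; apply: (mulfI x0).
    by rewrite -exprS prednK ?mulr1 ?expf_card // ltnW.
  - exact/filter_uniq/enum_uniq.
  rewrite -(cardC1 (0 : K)) cardE uniq_leq_size ?enum_uniq // => x.
  by rewrite mem_enum mem_filter mem_enum andbT.
by case/hasP=> w _; exists w.
Qed.

(** The two sides of [nprim_subgroup], freed from the choice of characters. *)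
Lemma nprim_subgroup_bounds (K : finFieldType) (r : nat) (Q := #|K|.-1)
    (Q' := (Q %/ r)%N) (c := Q%:R / (totient Q')%:R : algC)
    (E := (r * 2 ^ size (primes Q'))%:R * sqrtC #|K|%:R) (A B : {set K}) :
  (r %| Q)%N -> additive_subgroup A -> additive_subgroup B -> A \subset B ->
  let u := #|A|%:R / #|B|%:R in
  c * (nprim r A)%:R <= u * (c * (nprim r B)%:R) + E * (1 - u) /\
  u * (c * (nprim r B)%:R) <= c * (nprim r A)%:R + E * (1 - u).
Proof.
move=> rQ sA sB AB u.
have [psi [psiD npsi psi1]] := exists_additive_char K.
have [w prw] := exists_field_generator K.
have [z prz] := C_prim_root_exists (prim_order_gt0 prw).
have := nprim_subgroup prw prz psiD npsi psi1 rQ sA sB AB.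
rewrite -/u -/Q -/Q' -/c -/E.
set x := c * (_ - _) => xle.
have -> : u * (c * (nprim r B)%:R) = c * (u * (nprim r B)%:R) by rewrite mulrCA.
have xr : x \is Num.real.
  by rewrite /x /c /u !(rpredM, rpredB, rpredV, realn).
have le1 := le_trans (real_ler_norm xr) xle.
have le2 : - x <= E * (1 - u).
  by apply: le_trans xle; rewrite -normrN real_ler_norm // rpredN.
by move: le1 le2; rewrite /x mulrBr opprB !lerBlDl.
Qed.

(** If [V] is large, and each of the at most [m] subgroups in [s] is at least
    [q] times smaller than [V], then some element of [V] of order [Q'] avoids
    them all. *)
Lemma exists_prim_root_avoiding (K : finFieldType) (r m q M : nat)
    (V : {set K}) (s : seq {set K}) (Q' := (#|K|.-1 %/ r)%N) :
  (r %| #|K|.-1)%N -> (1 < q)%N -> (m ^ 2 <= q)%N -> (size s <= m)%N ->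
  additive_subgroup V -> (#|K| <= #|V| * M)%N ->
  (forall U, U \in s ->
     [/\ additive_subgroup U, U \subset V & #|U| * q <= #|V|]%N) ->
  ((r * (m + 2) * 2 ^ size (primes Q') * M) ^ 2 <= #|K|)%N ->
  exists x, [/\ x \in V, Q'.-primitive_root x & forall U, U \in s -> x \notin U].
Proof.
move=> rQ q1 mq sm subV VM subs leK.
have [w prw] := exists_field_generator K.
set Q := #|K|.-1 in rQ Q' prw leK *.
have Q_gt0 : (0 < Q)%N := prim_order_gt0 prw.
have r_gt0 : (0 < r)%N := dvdn_gt0 Q_gt0 rQ.
have Q'_gt0 : (0 < Q')%N by rewrite divn_gt0 // dvdn_leq.
have K1 : (1 < #|K|)%N := finNzRing_gt1 K.
have V_gt0 : 0 < #|V|%:R :> algC.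
  by rewrite ltr0n; apply/card_gt0P; exists 0; case: subV.
have K_gt0 : 0 < #|K|%:R :> algC by rewrite ltr0n ltnW.
apply: boolp.contrapT => none.
have leN : (nprim r V <= \sum_(U <- s) nprim r U)%N.
  have sub : [set x in V | Q'.-primitive_root x] \subset
      \bigcup_(U <- s) [set x in U | Q'.-primitive_root x].
    apply/subsetP=> x; rewrite inE => /andP[xV prx].
    rewrite bigcup_seq; apply/bigcupP; apply: boolp.contrapT => nU; apply: none.
    exists x; split=> // U Us; apply/negP => xU; apply: nU.
    by exists U => //; rewrite inE xU.
  apply: leq_trans (subset_leq_card sub) _.
  elim: (s) => [|U s' IHs]; first by rewrite !big_nil cards0.
  rewrite !big_cons; apply: leq_trans (leq_card_setU _ _) _.
  by rewrite leq_add2l.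
(* [X] is the normalized count in [V], [b] the density of [V] in [K], [S] the
   total density in [V] of the subgroups of [s], and [E] the error bound. *)
pose c : algC := Q%:R / (totient Q')%:R.
pose s0 : algC := sqrtC #|K|%:R.
pose E : algC := (r * 2 ^ size (primes Q'))%:R * s0.
pose X : algC := c * (nprim r V)%:R.
pose b : algC := #|V|%:R / #|K|%:R.
pose u (U : {set K}) : algC := #|U|%:R / #|V|%:R.
pose S := \sum_(U <- s) u U.
have s02 : s0 ^+ 2 = #|K|%:R by apply: sqrtCK.
have s0_gt1 : 1 < s0 by rewrite -sqrtC1 ltr_sqrtC ?nnegrE ?ler01 ?ler0n // ltr1n.
have s0_gt0 : 0 < s0 := lt_trans ltr01 s0_gt1.
have c_gt0 : 0 < c by rewrite divr_gt0 ?ltr0n ?totient_gt0.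
have b_gt0 : 0 < b by rewrite divr_gt0.
have E_gt1 : 1 < E.
  apply: lt_le_trans s0_gt1 _; rewrite ler_peMl ?(ltW s0_gt0) // ler1n.
  by rewrite muln_gt0 r_gt0 expn_gt0.
have E_gt0 : 0 < E := lt_trans ltr01 E_gt1.
have bM : 1 <= b * M%:R by rewrite mulrAC ler_pdivlMr // mul1r -natrM ler_nat.
have X_ge : b * Q%:R <= X + E * (1 - b).
  have [_] := nprim_subgroup_bounds rQ subV (additive_subgroupT K) (subsetT V).
  rewrite (nprim_setT prw rQ) cardsT -/b -/c -/X.
  by rewrite divfK // pnatr_eq0 -lt0n totient_gt0.
have X_le : X <= S * X + E * ((size s)%:R - S).
  apply: (@le_trans _ _ (\sum_(U <- s) (u U * X + E * (1 - u U)))).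
    apply: (@le_trans _ _ (\sum_(U <- s) (c * (nprim r U)%:R))).
      by rewrite -mulr_sumr -natr_sum ler_wpM2l ?(ltW c_gt0) // ler_nat.
    rewrite big_seq [leRHS]big_seq; apply: ler_sum => U /subs[subU UV _].
    by have [] := nprim_subgroup_bounds rQ subU subV UV.
  rewrite big_split /= -mulr_suml -mulr_sumr sumrB big_const_seq count_predT.
  by rewrite iter_addr_0.
have S_le : S * q%:R <= m%:R.
  apply: (@le_trans _ _ (size s)%:R); last by rewrite ler_nat.
  rewrite mulr_suml -sum1_size natr_sum big_seq [leRHS]big_seq.
  apply: ler_sum => U /subs[_ _ leU].
  by rewrite mulrAC ler_pdivrMr // mul1r -natrM ler_nat.
have q_gt0 : 0 < q%:R :> algC by rewrite ltr0n ltnW.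
have mS : m%:R * S <= 1.
  rewrite -(ler_pM2r q_gt0) mul1r -mulrA.
  apply: le_trans (ler_wpM2l (ler0n _ m) S_le) _.
  by rewrite -natrM ler_nat mulnn.
have d_gt0 : 0 < 1 - S.
  rewrite subr_gt0 -(ltr_pM2r q_gt0) mul1r; apply: le_lt_trans S_le _.
  rewrite ltr_nat; case: (m) mq => [_|[|m' mq]]; rewrite ?(ltnW q1) //.
  by apply: leq_trans mq; rewrite expnS expn1 ltn_Pmull.
(* Since [m * S <= 1], the factor [1 - S] times [m + 1] is at least [m - S]. *)
have X_le2 : X <= E * (m%:R + 1).
  rewrite -(ler_pM2l d_gt0) [X in _ <= X]mulrCA.
  have -> : (1 - S) * X = X - S * X by rewrite mulrBl mul1r.
  rewrite lerBlDl; apply: le_trans X_le _; rewrite lerD2l ler_pM2l //.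
  have -> : (1 - S) * (m%:R + 1) = m%:R - S + (1 - m%:R * S) by ring.
  rewrite -[leLHS]addr0; apply: lerD; last by rewrite subr_ge0.
  by rewrite lerD2r ler_nat.
have E_le : E * (m%:R + 2) <= b * s0 ^+ 2.
  have leS : (r * (m + 2) * 2 ^ size (primes Q') * M)%:R <= s0.
    rewrite -(@ler_pXn2r _ 2) ?nnegrE ?ler0n ?(ltW s0_gt0) //.
    by rewrite s02 -natrX ler_nat.
  apply: (@le_trans _ _ (b * ((r * (m + 2) * 2 ^ size (primes Q') * M)%:R * s0))).
    have -> : b * ((r * (m + 2) * 2 ^ size (primes Q') * M)%:R * s0) =
       (b * M%:R) * (E * (m%:R + 2)) by rewrite /E !natrM !natrD; ring.
    by rewrite ler_peMl // mulr_ge0 ?(ltW E_gt0) // -natrD ler0n.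
  by rewrite ler_pM2l // expr2 ler_pM2r.
have QE : Q%:R = s0 ^+ 2 - 1 :> algC.
  by rewrite s02 -[in RHS](prednK (ltnW K1)) -natr1 addrK.
have : b * Q%:R <= b * s0 ^+ 2 - E * b.
  apply: le_trans X_ge _; apply: le_trans (lerD X_le2 (lexx _)) _.
  have -> : E * (m%:R + 1) + E * (1 - b) = E * (m%:R + 2) - E * b by ring.
  by rewrite lerD2r.
rewrite QE mulrBr mulr1 lerD2l lerN2 -[leRHS]mul1r ler_pM2r // => E_le1.
by have := lt_le_trans E_gt1 E_le1; rewrite ltxx.
Qed.

(** * Kernels of linearized polynomials *)

Section Kernels.
Variables (F : finFieldType) (L : fieldExtType F).
Let q := #|F|.
Let n := \dim {:L}.
Local Notation KL := (finvect_type L : finFieldType).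

(** The kernel of [frobenius_poly c], as a finite set. *)
Definition frobenius_kernel (c : {poly F}) : {set KL} :=
  [set a : KL | frobenius_poly c (a : L) == 0].

Lemma card_finvect_type : #|KL| = (q ^ n)%N.
Proof.
by rewrite -(card_vspacef (Vector.class (finvect_type L))) card_vspace.
Qed.

Lemma frobenius_kernel_subgroup c : additive_subgroup (frobenius_kernel c).
Proof.
split=> [a b|a|]; rewrite !inE.
- by move=> /eqP a0 /eqP b0; rewrite frobenius_polyDr a0 b0 addr0.
- by move=> /eqP a0; rewrite frobenius_polyN a0 oppr0.
by rewrite frobenius_poly0r.
Qed.

Lemma frobenius_kernelS c d : frobenius_kernel d \subset frobenius_kernel (c * d).
Proof.
apply/subsetP=> a; rewrite !inE => /eqP da.
by rewrite frobenius_polyM da frobenius_poly0r.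
Qed.

Lemma card_frobenius_kernel_le c : c != 0 ->
  (#|frobenius_kernel c| <= q ^ (size c).-1)%N.
Proof.
move=> c0; rewrite cardE; apply: (size_frobenius_poly_kernel (L := L) c0).
  exact: enum_uniq.
apply/allP=> a a_ker; have : (a : KL) \in frobenius_kernel c by rewrite -mem_enum.
by rewrite inE.
Qed.

(** The image of [frobenius_poly f] lies in the kernel of [frobenius_poly g], and
    its fibres are no larger than the kernel of [frobenius_poly f]. *)
Lemma card_frobenius_kernel_mul (f g : {poly F}) : g * f = 'X^n - 1 ->
  (q ^ n <= #|frobenius_kernel g| * #|frobenius_kernel f|)%N.
Proof.
move=> XE; rewrite -card_finvect_type -[X in (X <= _)%N]sum1_card.
rewrite (partition_big (fun a : KL => frobenius_poly f (a : L) : KL)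
  (mem (frobenius_kernel g))) => [|a _] /=; last first.
  by rewrite inE -frobenius_polyM XE frobenius_polyXn_sub1.
rewrite -sum_nat_const; apply: leq_sum => b _.
rewrite sum1_card.
have [a0 a0b|none] := pickP (fun a : KL => (frobenius_poly f (a : L) : KL) == b).
  rewrite -(card_imset _ (addIr (- a0))); apply: subset_leq_card.
  apply/subsetP=> _ /imsetP[a ab ->]; rewrite inE frobenius_polyDr frobenius_polyN.
  by rewrite (eqP (ab : _ == b)) (eqP a0b) subrr.
by rewrite eq_card0 // => a; apply: none.
Qed.

End Kernels.

(** * Existence *)

Theorem proposition3p6 (R : realType) (n q : nat) (F : finFieldType)
    (L : fieldExtType F) (r k : nat) :
  (0 < n)%N ->
  #|F| = q ->
  \dim {:L} = n ->
  (r %| (q ^ n).-1)%N ->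
  k%:R < n%:R / 2 :> R ->
  (exists f : {poly F}, f %| 'X^n - 1 /\ size f = k.+1) ->
  ((n - k) ^ 2 <= q)%N ->
  q%:R `^ (n%:R / 2 - k%:R) >= (r * (n - k + 2) * W (q ^ n).-1)%:R :> R ->
  exists alpha : L, r_primitive r alpha /\ k_normal k alpha.
Proof.
move=> n_gt0 qE nE rQ ltk [f [fX sf]] mq leW.
have q1 : (1 < q)%N by rewrite -qE finNzRing_gt1.
have kn : (k < n)%N.
  have : k%:R < n%:R :> R.
    apply: lt_le_trans ltk _; rewrite ler_pdivrMr ?ltr0n //.
    by rewrite ler_peMr ?ler0n // ler1n.
  by rewrite ltr_nat.
have [g XE] := dvdpP _ _ fX.
have X0 : 'X^n - 1 != 0 :> {poly F} by rewrite -size_poly_eq0 size_Xn_sub_1.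
have [g0 f0] : g != 0 /\ f != 0 by apply/andP; rewrite -negb_or -mulf_eq0 -XE.
have sg : (size g).-1 = (n - k)%N.
  have : size (g * f) = n.+1 by rewrite -XE size_Xn_sub_1.
  by rewrite size_mul // sf addnS /= => E; rewrite -(addnK k (size g)) E subSn // ltnW.
have [s [ss sdiv smeet]] := irreducible_factors g0.
have s0 p : p \in s -> p != 0.
  by move=> /sdiv/andP[p1 _]; rewrite -size_poly_gt0 (ltn_trans _ p1).
pose ker := @frobenius_kernel F L.
have Q_gt0 : (0 < (q ^ n).-1)%N.
  by rewrite -subn1 subn_gt0 -{1}(expn0 q) ltn_exp2l.
have cardV : (q ^ (n - k) <= #|ker g|)%N.
  have qk : (0 < q ^ k)%N by rewrite expn_gt0 ltnW.
  rewrite -(leq_pmul2r qk) -expnD subnK ?(ltnW kn) //.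
  rewrite -{1}qE -{1}nE; apply: leq_trans (@card_frobenius_kernel_mul F L f g _) _.
    by rewrite nE XE.
  rewrite leq_mul2l (leq_trans (card_frobenius_kernel_le L f0)) ?orbT //.
  by rewrite sf qE.
have [||||||||x [xV prx xU]] := @exists_prim_root_avoiding (finvect_type L)
    r (n - k) q (q ^ k) (ker g) [seq ker (g %/ p) | p <- s].
- by rewrite card_finvect_type qE nE.
- exact: q1.
- exact: mq.
- by rewrite size_map -sg -ltnS prednK // size_poly_gt0.
- exact: frobenius_kernel_subgroup.
- rewrite card_finvect_type qE nE -{1}(subnK (ltnW kn)) expnD leq_mul2r cardV.
  by rewrite orbT.
- move=> _ /mapP[p ps ->]; have /andP[p1 /dvdpP[h gE]] := sdiv p ps.
  have h0 : h != 0 by apply: contraNneq g0 => h0; rewrite gE h0 mul0r.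
  have ghE : g %/ p = h by rewrite gE mulpK ?(s0 _ ps).
  split; first exact: frobenius_kernel_subgroup.
    by rewrite ghE /ker [in X in _ \subset X]gE mulrC frobenius_kernelS.
  apply: leq_trans cardV; rewrite ghE -sg.
  have -> : (size g).-1 = ((size h).-1 + (size p).-1)%N.
    rewrite gE size_mul ?(s0 _ ps) //.
    case: (size h) (size_poly_gt0 h) => [|sh]; first by rewrite h0.
    by case: (size p) p1 => // sp _ _; rewrite addnS.
  rewrite expnD leq_mul //; first by rewrite -qE card_frobenius_kernel_le.
  by rewrite -{1}(expn1 q) leq_pexp2l ?(ltnW q1) // -subn1 subn_gt0.
- rewrite card_finvect_type qE nE.
  apply: leq_trans (powR_half_natX _ ltk leW); last exact: ltnW.
  rewrite leq_exp2r // leq_mul2r leq_mul2l leq_W_dvd ?orbT //.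
  by apply/dvdnP; exists r; rewrite mulnC divnK.
exists x; split.
  by rewrite /r_primitive qE nE rQ /=; move: prx; rewrite card_finvect_type qE nE.
apply: (@k_normal_frobenius_poly F L f g s k x) => //; rewrite ?nE //.
- by move: xV; rewrite inE => /eqP.
move=> p ps; have : x \notin ker (g %/ p) by apply/xU/map_f.
by rewrite inE.
Qed.
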